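(* Let $S\in\{K,A\}$. If $S=K$, let $m\in\mathbb N$, $a>0$, let $t$ be a nonnegative integer, and let $\mathbf r=(r_j)_{j=1}^\infty$ be a sequence of positive reals with $0<r=r_1=\dots=r_{t+1}$ and $r_{t+2}\le r_{t+3}\le\cdots$. If $S=A$, let $m\in\mathbb N$, $a>0$, let $\mathbf r=(r_j)_{j=1}^\infty$ be a sequence of positive reals, and let $p\ge0$, $q>0$. Let $\mathcal I\in\{\mathbb Z^m_+,\mathbb Z^m\}$, $\mathcal J\in\{\mathbb Z^\infty_{+*},\mathbb Z^\infty_*\}$ and $d\in\mathbb N$. Then for every $T\ge1$ $$|G^S_{\mathcal I\times\mathcal J}(T)|\ \ge\ |G^S_{\mathcal I\times\mathcal J_d}(T)|\ \ge\ \lfloor T^{1/a}\rfloor^m .$$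
   Context: $\mathbb Z_+=\{0,1,2,\dots\}$; $\mathbb Z^\infty_*$ is the set of integer sequences $\mathbf s=(s_j)_{j\ge1}$ with finite support $\operatorname{supp}(\mathbf s)=\{j:s_j\neq0\}$; $\mathbb Z^\infty_{+*}$ is the subset of those with all $s_j\ge0$. $\mathcal J_d:=\{\mathbf s\in\mathcal J:\operatorname{supp}(\mathbf s)\subset\{1,\dots,d\}\}$. $|\cdot|$ denotes cardinality. The hyperbolic crosses are $$G^S_{\mathcal I\times\mathcal J}(T):=\{(\mathbf k,\mathbf s)\in\mathcal I\times\mathcal J:\lambda_S(\mathbf k,\mathbf s)\le T\},$$ and $G^S_{\mathcal I\times\mathcal J_d}(T)$ is defined in the same way with $\mathcal J$ replaced by $\mathcal J_d$, where $$\lambda_K(\mathbf k,\mathbf s)=\max_{1\le j\le m}(1+|k_j|)^a\prod_{j=1}^{t+1}(1+|s_j|)^r\prod_{j=t+2}^\infty(1+|s_j|)^{r_j},$$ $$\lambda_A(\mathbf k,\mathbf s)=\max_{1\le j\le m}(1+|k_j|)^a\prod_{j=1}^\infty(1+p|s_j|)^{-q}\exp\Big(\sum_{j=1}^\infty r_j|s_j|\Big).$$ *)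

(* Defs.v *)
(* MathComp-Analysis, over an abstract [R : realType]. *)
From HB Require Import structures.
From mathcomp Require Export all_boot all_order all_algebra.
From mathcomp Require Export all_classical all_reals all_analysis.
Set Implicit Arguments.
Unset Strict Implicit.
Unset Printing Implicit Defensive.
Import Order.TTheory GRing.Theory Num.Theory.
Local Open Scope classical_set_scope.
Local Open Scope ring_scope.

(* Sequences (x_j)_{j >= 1} are functions on nat with the index shifted by
   one: [x j] is the entry x_{j+1}. *)

(* Z^m is [setT : set 'rV[int]_m]. *)
Definition Zvec_ge0 (m : nat) : set 'rV[int]_m := [set k | forall j, 0 <= k 0 j].

Definition supp (s : nat -> int) : set nat := [set j | s j != 0].

Definition Zseq_fin : set (nat -> int) := [set s | finite_set (supp s)].

Definition Zseq_fin_ge0 : set (nat -> int) :=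
  Zseq_fin `&` [set s | forall j, 0 <= s j].

Definition Jtrunc (J : set (nat -> int)) (d : nat) : set (nat -> int) :=
  J `&` [set s | supp s `<=` `I_d].

(* [0] is a neutral default: the factors are positive and the theorem has
   [0 < m]. *)
Definition max_part (R : realType) (m : nat) (a : R) (k : 'rV[int]_m) : R :=
  \big[Num.max/0]_(j < m) (1 + `|k 0 j|)%:~R `^ a.

(* On finitely supported s all but finitely many factors of the infinite
   products below are 1 (resp. terms of the sum are 0), so the finitely
   supported big operators over an infinite index set give their values. *)

Definition lambdaK (R : realType) (m : nat) (a : R) (t : nat) (r : R)
    (rs : nat -> R) (k : 'rV[int]_m) (s : nat -> int) : R :=
  max_part a k
  * (\prod_(j < t.+1) (1 + `|s j|)%:~R `^ r)
  * \big[*%R/1]_(j \in [set j : nat | (t < j)%N]) ((1 + `|s j|)%:~R `^ rs j).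

Definition lambdaA (R : realType) (m : nat) (a : R) (rs : nat -> R) (p q : R)
    (k : 'rV[int]_m) (s : nat -> int) : R :=
  max_part a k
  * \big[*%R/1]_(j \in [set: nat]) ((1 + p * `|s j|%:~R) `^ (- q))
  * expR (\sum_(j \in [set: nat]) (rs j * `|s j|%:~R)).

Definition hyperbolic_cross (R : realType) (m : nat)
    (lambda : 'rV[int]_m -> (nat -> int) -> R)
    (I : set 'rV[int]_m) (J : set (nat -> int)) (T : R) :
    set ('rV[int]_m * (nat -> int)) :=
  [set ks | [/\ I ks.1, J ks.2 & lambda ks.1 ks.2 <= T]].

(* Main.v *)
Require Import Defs.
From mathcomp Require Import all_boot all_order all_algebra.
From mathcomp Require Import all_classical all_reals all_analysis.
Import Order.TTheory GRing.Theory Num.Theory.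
Local Open Scope classical_set_scope.
Local Open Scope card_scope.
Local Open Scope ring_scope.

(** At [s = 0] every factor of [lambda_S] that depends on [s] equals [1], both
    for [S = K] and for [S = A], so that [lambda_S(k, 0)] is the maximum over
    [j] of [(1 + |k_j|)^a].  With [N] the floor of [T^(1/a)], each of the
    [N ^ m] integer points [k] of the cube [{0, ..., N - 1}^m] satisfies
    [(1 + k_j)^a <= N^a <= T], and hence [(k, 0)] lies in the cross over
    [I * J_d].  This is [hyperbolic_cross_card_ge], and it gives the lower
    bound; the comparison of the two crosses is the inclusion of [J_d] in
    [J].  All points of the cube are nonnegative, which is why the same
    bound serves both choices of [I]. *)

Lemma card_ge_finType (F : finType) (U : Type) (B : set U) (f : F -> U) :
  injective f -> (forall x, B (f x)) -> B #>= `I_#|F|.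
Proof.
move=> f_inj fB; rewrite (card_le_eql card_II).
have g_inj : {in [set: 'I_#|F|] &, injective (f \o enum_val)}.
  by move=> i j _ _ /f_inj /enum_val_inj.
rewrite -(card_le_eql (inj_card_eq g_inj)); apply: subset_card_le.
by move=> _ [i _ <-]; exact: fB.
Qed.

Lemma hyperbolic_cross_subset (R : realType) (m : nat)
    (lambda : 'rV[int]_m -> (nat -> int) -> R) (I : set 'rV[int]_m)
    (J J' : set (nat -> int)) (T : R) :
  J `<=` J' -> hyperbolic_cross lambda I J T `<=` hyperbolic_cross lambda I J' T.
Proof. by move=> JJ' ks [Ik Js lamT]; split=> //; exact: JJ'. Qed.

Lemma lambdaK0 (R : realType) (m : nat) (a : R) (t : nat) (r : R)
    (rs : nat -> R) (k : 'rV[int]_m) :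
  lambdaK a t r rs k (fun=> 0) = max_part a k.
Proof.
rewrite /lambdaK big1 => [|j _]; last by rewrite normr0 addr0 powR1.
by rewrite fsbig1 ?mulr1 // => j _; rewrite normr0 addr0 powR1.
Qed.

Lemma lambdaA0 (R : realType) (m : nat) (a : R) (rs : nat -> R) (p q : R)
    (k : 'rV[int]_m) :
  lambdaA a rs p q k (fun=> 0) = max_part a k.
Proof.
rewrite /lambdaA fsbig1 => [|j _]; last by rewrite normr0 mulr0 addr0 powR1.
by rewrite fsbig1 ?expR0 ?mulr1 // => j _; rewrite normr0 mulr0.
Qed.

Lemma max_part_le (R : realType) (m : nat) (a T : R) (k : 'rV[int]_m) :
  0 < a -> 0 <= T ->
  (forall j, `|k 0 j| < (Num.truncn (T `^ a^-1))%:Z) -> max_part a k <= T.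
Proof.
move=> a_gt0 T_ge0 kN; apply: bigmax_le => // j _.
have TE : T = (T `^ a^-1) `^ a by rewrite -powRrM mulVf ?gt_eqF // powRr1.
rewrite [leRHS]TE.
apply: (ge0_ler_powR (ltW a_gt0)); rewrite ?nnegrE ?powR_ge0 //.
(* For integers the strict bound |k_j| < N is 1 + |k_j| <= N. *)
have : (1 + `|k 0 j|)%:~R <= (Num.truncn (T `^ a^-1))%:R :> R.
  by rewrite [leRHS]pmulrn ler_int addrC lezD1 kN.
by move/le_trans; apply; rewrite truncn_le powR_ge0.
Qed.

(** Only the values of [lambda] on the slice [s = 0] matter, so that a single
    count covers [S = K] and [S = A]. *)
Lemma hyperbolic_cross_card_ge (R : realType) (m : nat) (a : R)
    (lambda : 'rV[int]_m -> (nat -> int) -> R) (I : set 'rV[int]_m)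
    (J : set (nat -> int)) (T : R) :
  0 < a -> 0 <= T -> @Zvec_ge0 m `<=` I -> J (fun=> 0) ->
  (forall k, lambda k (fun=> 0) = max_part a k) ->
  hyperbolic_cross lambda I J T #>= `I_(Num.truncn (T `^ a^-1) ^ m).
Proof.
move=> a_gt0 T_ge0 geI J0 lambda0; set N := Num.truncn _.
pose point (g : {ffun 'I_m -> 'I_N}) : 'rV[int]_m * (nat -> int) :=
  (\row_j (g j : nat)%:Z, fun=> 0).
have <- : #|{: {ffun 'I_m -> 'I_N}}| = (N ^ m)%N by rewrite card_ffun !card_ord.
apply: (@card_ge_finType _ _ _ point) => [g h /(congr1 fst)/rowP gh|g].
  by apply/ffunP => j; apply/val_inj; have := gh j; rewrite !mxE => /= -[].
split=> //=; first by apply: geI => j; rewrite mxE.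
by rewrite lambda0; apply: max_part_le => // j; rewrite mxE; exact: ltn_ord.
Qed.

(* The crosses may be infinite, so cardinalities are compared with [#>=];
   [`I_n] is the set of naturals below n. *)
Theorem theorem2p13 (R : realType) (m : nat) (a : R) (rs : nat -> R)
    (I : set 'rV[int]_m) (J : set (nat -> int)) (d : nat) (T : R)
    (hm : (0 < m)%N) (ha : 0 < a) (hrs : forall j, 0 < rs j)
    (hI : I = @Zvec_ge0 m \/ I = [set: 'rV[int]_m])
    (hJ : J = Zseq_fin_ge0 \/ J = Zseq_fin)
    (hd : (0 < d)%N) (hT : 1 <= T) :
  (forall (t : nat) (r : R),
     0 < r ->
     (forall j, (j <= t)%N -> rs j = r) ->
     (forall i j, (t < i)%N -> (i <= j)%N -> rs i <= rs j) ->
     hyperbolic_cross (lambdaK a t r rs) I J T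
       #>= hyperbolic_cross (lambdaK a t r rs) I (Jtrunc J d) T /\
     hyperbolic_cross (lambdaK a t r rs) I (Jtrunc J d) T
       #>= `I_(Num.truncn (T `^ a^-1) ^ m)) /\
  (forall p q : R,
     0 <= p -> 0 < q ->
     hyperbolic_cross (lambdaA a rs p q) I J T
       #>= hyperbolic_cross (lambdaA a rs p q) I (Jtrunc J d) T /\
     hyperbolic_cross (lambdaA a rs p q) I (Jtrunc J d) T
       #>= `I_(Num.truncn (T `^ a^-1) ^ m)).
Proof.
have T_ge0 : 0 <= T := le_trans ler01 hT.
have geI : @Zvec_ge0 m `<=` I by case: hI => ->.
have J0 : Jtrunc J d (fun=> 0).
  have supp0 : supp (fun=> 0) = set0.
    by apply/seteqP; split=> j //=; rewrite /supp /= eqxx.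
  split; last by rewrite /= supp0; exact: sub0set.
  by case: hJ => ->; [split=> //|]; rewrite /Zseq_fin /= supp0.
have cross_trunc lambda : hyperbolic_cross lambda I J T
    #>= hyperbolic_cross lambda I (Jtrunc J d) T.
  by apply: subset_card_le; apply: hyperbolic_cross_subset; exact: subIsetl.
split=> [t r _ _ _|p q _ _]; split=> //;
  apply: hyperbolic_cross_card_ge => // k; [exact: lambdaK0|exact: lambdaA0].
Qed.
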